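(* Let $k\ge1$ and let $\mathcal{F}$ be a class of graphs of pathwidth at most $k-1$ with $k$-recognisability index $C$. Then for all graphs $G$ and $H$ on at most $n$ vertices, $G\equiv_{\mathcal{F}}H$ if and only if $G\equiv_{\mathcal{F}_{\le f(n,k,C)}}H$, where $f(n,k,C):=2Cn^k+k-1$.
   Context: $\hom(F,G)$ is the number of homomorphisms $F\to G$; $G\equiv_{\mathcal{F}}H$ means $\hom(F,G)=\hom(F,H)$ for all $F\in\mathcal{F}$. $\mathcal{F}_{\le\ell}:=\{F\in\mathcal{F}:|V(F)|\le\ell\}$. $\mathcal{D}(k)$ is the class of pairs $(F,\boldsymbol{u})$ with $\boldsymbol{u}\in V(F)^k$ having pairwise distinct entries; gluing $(F,\boldsymbol{u})\odot(F',\boldsymbol{u}')$ is the disjoint union with $u_i$ merged with $u'_i$ for all $i$; $\operatorname{soe}(F,\boldsymbol{u}):=F$. $\boldsymbol{F}_1\sim_{\mathcal{F}}\boldsymbol{F}_2$ iff for all $\boldsymbol{K}\in\mathcal{D}(k)$: $\operatorname{soe}(\boldsymbol{K}\odot\boldsymbol{F}_1)\in\mathcal{F}\iff\operatorname{soe}(\boldsymbol{K}\odot\boldsymbol{F}_2)\in\mathcal{F}$. The $k$-recognisability index of $\mathcal{F}$ is the (assumed finite) number of equivalence classes of $\sim_{\mathcal{F}}$. *)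

(* Defs.v *)
(* MathComp world; boolp only serves to minimise over a Prop in [pathwidth]. *)
From HB Require Import structures.
From mathcomp Require Import all_boot boolp.

Set Implicit Arguments.
Unset Strict Implicit.
Unset Printing Implicit Defensive.

(** * Finite simple graphs *)

Record sgraph := SGraph {
  vertex :> finType;
  edge : rel vertex;
  edge_sym : symmetric edge;
  edge_irr : irreflexive edge }.

Definition isomorphic (F G : sgraph) : Prop :=
  exists2 h : F -> G, bijective h & forall x y, edge (h x) (h y) = edge x y.

Definition hom (F G : sgraph) : nat :=
  #|[pred h : {ffun F -> G} |
      [forall x, forall y, edge x y ==> edge (h x) (h y)]]|.

(* A class of graphs is an isomorphism-closed predicate on [sgraph]. *)
Definition iso_closed (cF : sgraph -> Prop) : Prop :=
  forall F G, isomorphic F G -> cF F -> cF G.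

Definition hom_indist (cF : sgraph -> Prop) (G H : sgraph) : Prop :=
  forall F, cF F -> hom F G = hom F H.

Definition restr_size (cF : sgraph -> Prop) (l : nat) : sgraph -> Prop :=
  fun F => cF F /\ #|F| <= l.

(** * Pathwidth *)

Definition path_decomposition (G : sgraph) (s : seq {set G}) : Prop :=
  [/\ forall x : G, exists2 B : {set G}, B \in s & x \in B,
      forall x y : G, edge x y ->
        exists2 B : {set G}, B \in s & (x \in B) && (y \in B)
    & forall i j l, i <= j -> j <= l -> l < size s ->
        nth set0 s i :&: nth set0 s l \subset nth set0 s j].

(* Truncated predecessor: the graph without vertices gets width 0, not -1. *)
Definition width (G : sgraph) (s : seq {set G}) : nat :=
  (\max_(B <- s) #|B|).-1.

Lemma path_decomposition_exists (G : sgraph) :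
  exists w, `[< exists2 s : seq {set G}, path_decomposition s & width s = w >].
Proof.
exists (width [:: [set: G]]); apply/asboolP; exists [:: [set: G]] => //; split.
- by move=> x; exists [set: G]; rewrite ?mem_head ?inE.
- by move=> x y _; exists [set: G]; rewrite ?mem_head ?inE.
- move=> i j l ij jl; rewrite /= ltnS leqn0 => /eqP l0; move: jl.
  by rewrite l0 leqn0 => /eqP ->; rewrite subsetIr.
Qed.

Definition pathwidth (G : sgraph) : nat := ex_minn (path_decomposition_exists G).

(** * Distinctly labelled graphs and gluing *)

Record dlgraph (k : nat) := DLGraph {
  soe : sgraph;
  label : {ffun 'I_k -> soe};
  label_inj : injective label }.

Section Gluing.
Variables (k : nat) (K F : dlgraph k).

(* The vertices of the gluing: those of [K], together with the unlabelled
   vertices of [F]; the i-th label of [F] is represented by that of [K]. *)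
Definition glue_vertex : finType :=
  (soe K + {v : soe F | v \notin codom (label F)})%type.

Definition glue_l (v : soe K) : glue_vertex := inl v.

Definition glue_r (v : soe F) : glue_vertex :=
  match boolP (v \in codom (label F)) with
  | AltTrue v_lab => inl (label K (iinv v_lab))
  | AltFalse v_unlab => inr (Sub v v_unlab)
  end.

Lemma glue_r_label i : glue_r (label F i) = glue_l (label K i).
Proof.
rewrite /glue_r; destruct (boolP _) as [p|p]; last by case/negP: (p); apply: codom_f.
by congr (inl (label K _)); apply: (@label_inj _ F); rewrite f_iinv.
Qed.

Lemma glue_r_inj : injective glue_r.
Proof.
rewrite /glue_r => v w.
destruct (boolP (v \in codom (label F))) as [p|p];
  destruct (boolP (w \in codom (label F))) as [q|q] => //.
- by case=> /(@label_inj _ K) e; rewrite -(f_iinv p) -(f_iinv q) e.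
- by case.
Qed.

(* Parallel edges between labelled vertices are identified. *)
Definition glue_edge : rel glue_vertex := fun x y =>
  [exists a, exists b, [&& edge a b, glue_l a == x & glue_l b == y]] ||
  [exists a, exists b, [&& edge a b, glue_r a == x & glue_r b == y]].

Lemma glue_edge_sym : symmetric glue_edge.
Proof.
suff sub x y : glue_edge x y -> glue_edge y x by move=> x y; apply/idP/idP; apply: sub.
case/orP=> /existsP[a] /existsP[b] /and3P[ab ax by_]; apply/orP; [left|right];
  by apply/existsP; exists b; apply/existsP; exists a; rewrite edge_sym ab ax by_.
Qed.

Lemma glue_edge_irr : irreflexive glue_edge.
Proof.
move=> x; apply/negP; case/orP=> /existsP[a] /existsP[b] /and3P[ab /eqP ax /eqP].
- by rewrite -ax => -[e]; rewrite e edge_irr in ab.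
- by rewrite -ax => /glue_r_inj e; rewrite e edge_irr in ab.
Qed.

Definition glue_sgraph : sgraph := SGraph glue_edge_sym glue_edge_irr.

Definition glue_label : {ffun 'I_k -> glue_sgraph} :=
  [ffun i => glue_l (label K i)].

Lemma glue_label_inj : injective glue_label.
Proof. by move=> i j; rewrite !ffunE => -[] /(@label_inj _ K). Qed.

Definition glue : dlgraph k := DLGraph glue_label_inj.

End Gluing.

(** * Recognisability *)

Definition rec_equiv (cF : sgraph -> Prop) (k : nat) (F1 F2 : dlgraph k) : Prop :=
  forall K : dlgraph k, cF (soe (glue K F1)) <-> cF (soe (glue K F2)).

(* [rec_equiv cF (k := k)] has exactly [C] classes: [q] is the quotient map,
   onto a set of size [C].  (Sets of [dlgraph k] are too large, universe-wise,
   for the cardinality of mathcomp-classical.) *)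
Definition recognisability_index (cF : sgraph -> Prop) (k C : nat) : Prop :=
  exists q : dlgraph k -> 'I_C,
    (forall i, exists F, q F = i) /\
    (forall F1 F2, q F1 = q F2 <-> rec_equiv cF F1 F2).

(* Main.v *)
From mathcomp Require Import all_boot all_algebra zify boolp.
From HB Require Import structures.
Require Import Defs.

(** Sort the vertices of [F] by the first bag containing them, and introduce them
    in this order.  When [v] appears, the earlier vertices that still matter lie
    in its first bag, so that [k] labels suffice: a label sitting outside this
    bag is moved to [v].  Hence a graph of pathwidth at most [k - 1] on at least
    [k] vertices is spelled out by a word over finitely many operations "move
    label [i] to a fresh vertex, then add edges between labels", one letter per
    vertex after the first [k].  These operations are self-adjoint for gluing,
    so they respect [rec_equiv], and they act linearly on the homomorphism counts
    to [G] and [H] with prescribed labels.  The word therefore drives a linear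
    automaton whose state, [e_c] tensor the count vectors with [c] the
    recognisability class, lives in dimension [d = C (|G|^k + |H|^k)], and
    [hom F G - hom F H] is a linear functional of the state on the accepting
    classes.  The spans of the states reached by words of length at most [l]
    stop growing at some [l < d], so a functional vanishing on all words of
    length less than [d] vanishes on all words. *)

Set Implicit Arguments.
Unset Strict Implicit.
Unset Printing Implicit Defensive.

Import GRing.Theory Num.Theory.

(** * Runs of a linear automaton and their Krylov spaces *)

Definition run (K : fieldType) (V : vectType K) (A : finType) (f : A -> 'End(V))
    (x : V) (s : seq A) : V :=
  foldl (fun v a => f a v) x s.

Section Krylov.
Local Open Scope ring_scope.
Variables (K : fieldType) (V : vectType K) (A B : finType).
Variables (f : A -> 'End(V)) (x : B -> V).

Definition stable (W : {vspace V}) := forall a, (f a @: W <= W)%VS.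

Fixpoint krylov (n : nat) : {vspace V} :=
  if n is m.+1 then (krylov m + \sum_a (f a @: krylov m))%VS
  else (\sum_b <[x b]>)%VS.

Lemma krylov_le_succ n : (krylov n <= krylov n.+1)%VS.
Proof. exact: addvSl. Qed.

Lemma krylov_stableS n : stable (krylov n) -> krylov n.+1 = krylov n.
Proof.
move=> st; apply/eqP; rewrite eqEsubv krylov_le_succ andbT.
by rewrite subv_add subvv; apply/subv_sumP => a _; apply: st.
Qed.

(** Each step either stabilises the chain for good or raises the dimension. The strict bound holds
    from the start because a zero [krylov 0] is already stable. *)
Lemma krylov_dim n : stable (krylov n) \/ (n < \dim (krylov n))%N.
Proof.
elim: n => [|n [st|lt]].
- case: (posnP (\dim (krylov 0))) => [/eqP|]; last by right.
  rewrite dimv_eq0 => /eqP ->; left => a.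
  by rewrite limg0 subvv.
- by left; rewrite /stable krylov_stableS.
- case: (eqVneq (krylov n) (krylov n.+1)) => [e|ne].
    left=> a; rewrite -e {2}e /=.
    by apply: subv_trans (addvSr _ _); apply: (sumv_sup a); rewrite ?subvv.
  right; apply: leq_ltn_trans lt _.
  rewrite ltn_neqAle (dimvS (krylov_le_succ n)) andbT.
  by apply: contra ne => /eqP e; rewrite eqEdim krylov_le_succ -e leqnn.
Qed.

Lemma krylov_stable : stable (krylov (dim V).-1).
Proof.
case: (krylov_dim (dim V).-1) => //; rewrite -dimvf => lt.
have full : krylov (\dim {:V}).-1 = fullv.
  apply/eqP; rewrite eqEdim subvf /=; move: lt.
  by case: (\dim {:V}).
by move=> a; rewrite full subvf.
Qed.

(** The span of the runs of length at most [n] is described by minimality. The statement quantifies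
    over [U] because the induction passes to preimages of [U]. *)
Lemma krylov_min n (U : {vspace V}) :
  (forall b s, (size s <= n)%N -> run f (x b) s \in U) -> (krylov n <= U)%VS.
Proof.
elim: n U => [|n IHn] U sU /=.
  by apply/subv_sumP => b _; rewrite -memvE; apply: (sU b [::]).
rewrite subv_add IHn => [|b s ss]; last by apply: sU; rewrite leqW.
(* The last letter [a] is absorbed into the target: the induction hypothesis is applied to the
   preimage of [U] under [f a]. *)
apply/subv_sumP => a _; apply/subvP => _ /memv_imgP[v vW ->]; rewrite memv_preim.
apply: (subvP (IHn _ _)) vW => b s ss; rewrite -memv_preim.
by have := sU b (rcons s a); rewrite size_rcons /run foldl_rcons; apply.
Qed.

Lemma run_krylov b s : run f (x b) s \in krylov (dim V).-1.
Proof.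
elim/last_ind: s => [|s a IHs].
  have mono n : (krylov 0 <= krylov n)%VS.
    by elim: n => [|n IHn]; rewrite ?subvv // (subv_trans IHn) ?krylov_le_succ.
  apply: (subvP (mono _)); rewrite /run /= memvE; exact: (sumv_sup b).
rewrite /run foldl_rcons; apply: (subvP (krylov_stable a)).
exact: memv_img.
Qed.

(** The kernel of [phi] contains all runs of length at most [dim V - 1], hence their span, which is
    stable and so contains every run. *)
Lemma run_vanish (phi : 'Hom(V, K^o)) :
  (forall b s, (size s < dim V)%N -> phi (run f (x b) s) = 0) ->
  forall b s, phi (run f (x b) s) = 0.
Proof.
move=> short b s; apply/eqP; rewrite -memv_ker.
(* In dimension 0 no word is short enough for [short] to apply, but then every vector is zero. *)
case: (posnP (dim V)) => [dim0|dim_gt0].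
  suff -> : run f (x b) s = 0 by rewrite mem0v.
  apply/eqP; rewrite -memv0; move: (dimvf V); rewrite dim0 => /eqP.
  by rewrite dimv_eq0 => /eqP <-; rewrite memvf.
apply: (subvP (krylov_min _)) (run_krylov b s) => b' s' le.
by rewrite memv_ker short // (leq_ltn_trans le) // ltn_predL.
Qed.

End Krylov.

(** * Isomorphisms and gluing as a pushout *)

Lemma isomorphic_sym F G : isomorphic F G -> isomorphic G F.
Proof.
case=> h [g gK hK] hE; exists g; first by exists h.
by move=> x y; rewrite -hE !hK.
Qed.

Lemma inj_surj_bij (S T : finType) (h : S -> T) :
  injective h -> (forall y, exists x, h x = y) -> bijective h.
Proof.
move=> h_inj h_surj; apply: inj_card_bij => //.
rewrite -(card_codom h_inj); apply/subset_leq_card/subsetP => y _.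
by have [x <-] := h_surj y; apply: codom_f.
Qed.

Section GlueTheory.
Variables (k : nat) (K F : dlgraph k).

Lemma glue_l_inj : injective (@glue_l k K F).
Proof. by move=> x y []. Qed.

Lemma glue_lr x y : @glue_l k K F x = glue_r K y ->
  exists2 j, x = label K j & y = label F j.
Proof.
rewrite /glue_r; destruct (boolP _) as [p|p] => // -[->].
by exists (iinv p); rewrite ?f_iinv.
Qed.

Lemma glue_cover (z : soe (glue K F)) :
  (exists x, @glue_l k K F x = z) \/ (exists y, glue_r K y = z).
Proof.
case: z => [x|[y y_unlab]]; [by left; exists x | right; exists y].
rewrite /glue_r; destruct (boolP _) as [p|p]; first by case/negP: y_unlab.
by congr inr; apply: val_inj.
Qed.

Lemma glue_edgeP (z z' : soe (glue K F)) :
  edge z z' <->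
  (exists a b, [/\ edge a b, @glue_l k K F a = z & @glue_l k K F b = z']) \/
  (exists a b, [/\ edge a b, @glue_r k K F a = z & @glue_r k K F b = z']).
Proof.
split.
  by case/orP=> /existsP[a] /existsP[b] /and3P[ab /eqP az /eqP bz];
    [left|right]; exists a, b.
by case=> -[a] [b] [ab <- <-]; apply/orP; [left|right];
  apply/existsP; exists a; apply/existsP; exists b; rewrite ab !eqxx.
Qed.

(** A gluing is determined up to isomorphism by two jointly surjective embeddings that meet exactly
    in the labels and jointly produce all edges. This criterion hides the asymmetric encoding of
    [glue_vertex]. *)
Lemma glue_pushout (X : sgraph) (f : soe K -> X) (g : soe F -> X) :
  injective f -> injective g ->
  (forall j, f (label K j) = g (label F j)) ->
  (forall x y, f x = g y -> exists2 j, x = label K j & y = label F j) ->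
  (forall z, (exists x, f x = z) \/ (exists y, g y = z)) ->
  (forall z z', edge z z' <->
     (exists a b, [/\ edge a b, f a = z & f b = z']) \/
     (exists a b, [/\ edge a b, g a = z & g b = z'])) ->
  isomorphic (soe (glue K F)) X.
Proof.
move=> f_inj g_inj fg_lab fg_meet fg_cover fg_edge.
pose h (z : soe (glue K F)) := match z with inl x => f x | inr y => g (val y) end.
have hl x : h (glue_l F x) = f x by [].
have hr y : h (glue_r K y) = g y.
  rewrite /glue_r; destruct (boolP _) as [p|p] => //=.
  by rewrite fg_lab f_iinv.
have h_inj : injective h.
  have lr x y : h (glue_l F x) = h (glue_r K y) -> glue_l F x = glue_r K y.
    by rewrite hl hr => /fg_meet[j -> ->]; rewrite glue_r_label.
  move=> z z'.
  case: (glue_cover z) (glue_cover z') => -[x <-] [] [y <-].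
  - by rewrite !hl => /f_inj ->.
  - exact: lr.
  - by move/esym/lr.
  - by rewrite !hr => /g_inj ->.
exists h.
  apply: inj_surj_bij => // z; case: (fg_cover z) => -[x <-].
    by exists (glue_l F x).
  by exists (glue_r K x).
move=> z z'; apply/idP/idP.
- move/fg_edge => H; apply/glue_edgeP; case: H => -[a] [b] [ab az bz].
    by left; exists a, b; split=> //; apply: h_inj; rewrite hl.
  by right; exists a, b; split=> //; apply: h_inj; rewrite hr.
- move/glue_edgeP => H; apply/fg_edge; case: H => -[a] [b] [ab <- <-].
    by left; exists a, b; rewrite !hl.
  by right; exists a, b; rewrite !hr.
Qed.

End GlueTheory.

(** * Operations on labelled graphs *)

Section AddEdges.
Variables (k : nat) (E : {set 'I_k * 'I_k}).

(** Symmetrising and removing loops makes every set [E] admissible, so that the letters form a plain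
    finite type. *)
Definition pattern : rel 'I_k :=
  fun j l => (j != l) && (((j, l) \in E) || ((l, j) \in E)).

Lemma pattern_sym : symmetric pattern.
Proof. by move=> j l; rewrite /pattern eq_sym orbC. Qed.

Variable F : dlgraph k.

Definition add_edge : rel (soe F) := fun x y =>
  edge x y ||
  [exists j, exists l, [&& pattern j l, label F j == x & label F l == y]].

Lemma add_edgeP x y : reflect
  (edge x y \/ exists j l, [/\ pattern j l, label F j = x & label F l = y])
  (add_edge x y).
Proof.
apply: (iffP orP) => -[xy|]; try (by left); right.
  by case/existsP: b => j /existsP[l] /and3P[jl /eqP jx /eqP ly]; exists j, l.
case: b => j [l] [jl <- <-].
by apply/existsP; exists j; apply/existsP; exists l; rewrite jl !eqxx.
Qed.

Lemma add_edge_sym : symmetric add_edge.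
Proof.
suff sub x y : add_edge x y -> add_edge y x by move=> x y; apply/idP/idP; apply: sub.
case/add_edgeP=> [xy|[j] [l] [jl jx ly]]; apply/add_edgeP.
  by left; rewrite edge_sym.
by right; exists l, j; rewrite pattern_sym.
Qed.

Lemma add_edge_irr : irreflexive add_edge.
Proof.
move=> x; apply/negP => /add_edgeP[|[j] [l] [jl jx lx]]; first by rewrite edge_irr.
by move: jl; rewrite /pattern (label_inj (etrans jx (esym lx))) eqxx.
Qed.

Definition add_edges : dlgraph k :=
  @DLGraph k (SGraph add_edge_sym add_edge_irr) (label F) (@label_inj k F).

End AddEdges.

Section Introduce.
Variables (k : nat) (i : 'I_k) (F : dlgraph k).

Definition intro_edge : rel (option (soe F)) := fun x y =>
  match x, y with Some x, Some y => edge x y | _, _ => false end.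

Lemma intro_edge_sym : symmetric intro_edge.
Proof. by case=> [x|] [y|] //=; apply: edge_sym. Qed.

Lemma intro_edge_irr : irreflexive intro_edge.
Proof. by case=> [x|] //=; apply: edge_irr. Qed.

Definition intro_label : {ffun 'I_k -> option (soe F)} :=
  [ffun j => if j == i then None else Some (label F j)].

Lemma intro_label_inj : injective intro_label.
Proof.
move=> j l; rewrite !ffunE; case: eqP => [->|_]; case: eqP => [->|_] //.
by case=> /label_inj.
Qed.

Definition introduce : dlgraph k :=
  @DLGraph k (SGraph intro_edge_sym intro_edge_irr) intro_label intro_label_inj.

End Introduce.

(* Pushing an operation from one side of a gluing to the other makes
   [rec_equiv] a congruence for it. *)
Lemma glue_add_edges k (E : {set 'I_k * 'I_k}) (K F : dlgraph k) :
  isomorphic (soe (glue (add_edges E K) F)) (soe (glue K (add_edges E F))).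
Proof.
pose f : soe (add_edges E K) -> soe (glue K (add_edges E F)) := @glue_l k K (add_edges E F).
pose g : soe F -> soe (glue K (add_edges E F)) := @glue_r k K (add_edges E F).
apply: (@glue_pushout _ _ _ _ f g).
- exact: glue_l_inj.
- exact: (@glue_r_inj _ K (add_edges E F)).
- by move=> j; rewrite /g (@glue_r_label _ K (add_edges E F)).
- by move=> x y; apply: (@glue_lr _ K (add_edges E F)).
- exact: glue_cover.
have lab j : f (label K j) = g (label F j).
  by rewrite /g (@glue_r_label _ K (add_edges E F)).
move=> z z'; rewrite glue_edgeP; split.
- case=> [[a] [b] [ab <- <-]|[a] [b] [/add_edgeP ab <- <-]].
    by left; exists a, b; split=> //; apply/add_edgeP; left.
  case: ab => [ab|[j] [l] [jl ja lb]]; first by right; exists a, b.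
  left; exists (label K j), (label K l); split; first by apply/add_edgeP; right; exists j, l.
    by rewrite lab ja.
  by rewrite lab lb.
- case=> [[a] [b] [/add_edgeP ab <- <-]|[a] [b] [ab <- <-]].
    case: ab => [ab|[j] [l] [jl ja lb]]; first by left; exists a, b.
    right; exists (label F j), (label F l); split; first by apply/add_edgeP; right; exists j, l.
      by rewrite -ja; symmetry; apply: lab.
    by rewrite -lb; symmetry; apply: lab.
  by right; exists a, b; split=> //; apply/add_edgeP; left.
Qed.

(** Both sides are [K] and [F] merged along the labels other than [i]. The fresh isolated vertex is
    absorbed by the vertex labelled [i] on the opposite side, and the two old [i]-th vertices stay
    apart. *)
Lemma glue_introduce k (i : 'I_k) (K F : dlgraph k) :
  isomorphic (soe (glue (introduce i K) F)) (soe (glue K (introduce i F))).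
Proof.
pose F' := introduce i F.
pose g (y : soe F) : soe (glue K F') := @glue_r k K F' (Some y).
pose f (x : soe (introduce i K)) : soe (glue K F') :=
  if x is Some x then @glue_l k K F' x else g (label F i).
have lab j : f (label (introduce i K) j) = g (label F j).
  rewrite /= ffunE; case: eqP => [->//|/eqP ji] /=.
  by rewrite /g -(@glue_r_label k K F') /= ffunE (negbTE ji).
have g_inj : injective g by move=> x y /glue_r_inj [].
have meet x y : @glue_l k K F' x = g y ->
    exists j, [/\ j != i, x = label K j & y = label F j].
  move=> /glue_lr[j xj]; rewrite /= ffunE; case: ifP => // ji [yj].
  by exists j; rewrite ji.
apply: (@glue_pushout _ _ _ _ f g) => //.
- move=> [x|] [y|] //=.
  + by case=> ->.
  + by case/meet=> j [ji _ /label_inj eji]; rewrite eji eqxx in ji.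
  + by move/esym/meet=> [j [ji _ /label_inj eji]]; rewrite eji eqxx in ji.
- move=> [x|] y /=.
  + by case/meet=> j [ji -> ->]; exists j => //; rewrite ffunE (negbTE ji).
  + by move/g_inj <-; exists i => //; rewrite ffunE eqxx.
- move=> z; case: (glue_cover z) => -[]; first by move=> x <-; left; exists (Some x).
  case=> [y|] <-; first by right; exists y.
  left; exists (Some (label K i)) => /=.
  by rewrite -(@glue_r_label k K F') /= ffunE eqxx.
move=> z z'; rewrite glue_edgeP; split.
- case=> [[a] [b] [ab <- <-]|[[a|]] [[b|]] [ab <- <-]] //.
    by left; exists (Some a), (Some b).
  by right; exists a, b.
- case=> [[[a|]] [[b|]] [ab <- <-]|[a] [b] [ab <- <-]] //.
    by left; exists a, b.
  by right; exists (Some a), (Some b).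
Qed.

Lemma discrete_sym (k : nat) : symmetric (fun _ _ : 'I_k => false).
Proof. by []. Qed.

Lemma discrete_irr (k : nat) : irreflexive (fun _ _ : 'I_k => false).
Proof. by []. Qed.

Lemma discrete_label_inj (k : nat) : injective [ffun j : 'I_k => j].
Proof. by move=> j l; rewrite !ffunE. Qed.

(** The unit for gluing. It lets [rec_equiv] speak about [soe F] itself, and it is the graph from
    which words start. *)
Definition discrete (k : nat) : dlgraph k :=
  @DLGraph k (SGraph (@discrete_sym k) (@discrete_irr k)) [ffun j => j]
    (@discrete_label_inj k).

Lemma glue_discrete k (F : dlgraph k) : isomorphic (soe (glue (discrete k) F)) (soe F).
Proof.
apply: (@glue_pushout _ _ _ _ (label F : soe (discrete k) -> soe F) id) => //.
- exact: label_inj.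
- by move=> j; rewrite /= ffunE.
- by move=> j y <-; exists j; rewrite //= ffunE.
- by move=> z; right; exists z.
- move=> z z'; split=> [zz'|]; first by right; exists z, z'.
  by case=> [[a] [b] []//|[a] [b] [ab <- <-]].
Qed.

(** * Recognisability equivalence as a congruence *)

Section Congruence.
Variables (cF : sgraph -> Prop) (cF_iso : iso_closed cF) (k : nat).

Lemma iso_closedE F G : isomorphic F G -> cF F <-> cF G.
Proof. by move=> FG; split; apply: cF_iso => //; apply: isomorphic_sym. Qed.

Lemma rec_equiv_soe (F1 F2 : dlgraph k) :
  rec_equiv cF F1 F2 -> cF (soe F1) <-> cF (soe F2).
Proof.
by move/(_ (discrete k)); rewrite !(iso_closedE (glue_discrete _)).
Qed.

Lemma rec_equiv_add_edges E (F1 F2 : dlgraph k) :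
  rec_equiv cF F1 F2 -> rec_equiv cF (add_edges E F1) (add_edges E F2).
Proof. by move=> eqF K; rewrite -!(iso_closedE (glue_add_edges _ _ _)); apply: eqF. Qed.

Lemma rec_equiv_introduce i (F1 F2 : dlgraph k) :
  rec_equiv cF F1 F2 -> rec_equiv cF (introduce i F1) (introduce i F2).
Proof. by move=> eqF K; rewrite -!(iso_closedE (glue_introduce _ _ _)); apply: eqF. Qed.

End Congruence.

(** * Homomorphism counts with prescribed labels *)

Definition is_hom (F G : sgraph) (h : F -> G) : bool :=
  [forall x, forall y, edge x y ==> edge (h x) (h y)].

Lemma is_homP (F G : sgraph) (h : F -> G) :
  reflect (forall x y, edge x y -> edge (h x) (h y)) (is_hom h).
Proof.
apply: (iffP forallP) => [H x y xy|H x]; first exact: implyP (forallP (H x) y) xy.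
by apply/forallP => y; apply/implyP; apply: H.
Qed.

Lemma hom_iso F F' G : isomorphic F F' -> hom F G = hom F' G.
Proof.
have le A B : isomorphic A B -> hom A G <= hom B G.
  case=> h [g hK gK] hE; pose c (u : {ffun A -> G}) := [ffun y => u (g y)].
  have c_inj : injective c.
    by move=> u v /ffunP e; apply/ffunP => x; have := e (h x); rewrite !ffunE hK.
  rewrite /hom -(card_image c_inj); apply/subset_leq_card/subsetP => _ /imageP[u uP ->].
  apply/(@is_homP B G) => x y xy; rewrite !ffunE; apply: (@is_homP A G _ uP).
  by rewrite -hE !gK.
by move=> iso; apply/eqP; rewrite eqn_leq !le //; apply: isomorphic_sym.
Qed.

Section LabelledHom.
Variables (k : nat) (G : sgraph).
Implicit Types (F : dlgraph k) (a b : {ffun 'I_k -> G}).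

Definition lhom F a : nat :=
  #|[pred h : {ffun soe F -> G} |
      is_hom h & [ffun j => h (label F j)] == a]|.

Definition compatible (E : {set 'I_k * 'I_k}) a : bool :=
  [forall j, forall l, pattern E j l ==> edge (a j) (a l)].

Definition agree_off (i : 'I_k) a b : bool := [forall j, (j != i) ==> (a j == b j)].

Lemma hom_lhom F : hom (soe F) G = \sum_a lhom F a.
Proof.
rewrite /hom -sum1_card.
rewrite (partition_big (fun h : {ffun soe F -> G} => [ffun j => h (label F j)]) predT) //.
by apply: eq_bigr => a _; rewrite /lhom -sum1_card; apply: eq_bigl.
Qed.

(** Once the images of the labels are fixed, edges between labels only decide whether these images
    are allowed: a factor 0 or 1. *)
Lemma lhom_add_edges E F a :
  lhom (add_edges E F) a = compatible E a * lhom F a.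
Proof.
case: (boolP (compatible E a)) => [/forallP Ea|nEa].
  rewrite mul1n; apply: eq_card => h; rewrite !inE /=.
  case: eqP => [ha|_]; rewrite ?andbF // !andbT.
  apply/is_homP/is_homP => hh x y xy; first by apply: hh; apply/add_edgeP; left.
  case/add_edgeP: xy => [|[j [l [jl <- <-]]]]; first exact: hh.
  by have := implyP (forallP (Ea j) l) jl; rewrite -ha !ffunE.
rewrite mul0n; apply: eq_card0 => h; rewrite !inE.
apply: contraNF nEa => /andP[/is_homP hh /eqP <-].
apply/forallP => j; apply/forallP => l; apply/implyP => jl; rewrite !ffunE.
by apply: hh; apply/add_edgeP; right; exists j, l.
Qed.

(** The fresh vertex is isolated and its image is forced to be [a i]. The vertex that loses label
    [i] may go anywhere, hence the sum over labellings that agree with [a] off [i]. *)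
Lemma lhom_introduce i F a :
  lhom (introduce i F) a = \sum_(b | agree_off i b a) lhom F b.
Proof.
pose res (h : {ffun soe F -> G}) : {ffun 'I_k -> G} := [ffun j => h (label F j)].
transitivity #|[pred h : {ffun soe F -> G} | is_hom h & agree_off i (res h) a]|; last first.
  rewrite -sum1_card (partition_big res (fun b => agree_off i b a)) /=; last first.
    by move=> h /andP[].
  apply: eq_bigr => b ba; rewrite /lhom -sum1_card; apply: eq_bigl => h.
  rewrite !inE; case: eqP => [->|_]; rewrite ?andbF // ba !andbT //.
pose ext (h : {ffun soe F -> G}) : {ffun option (soe F) -> G} :=
  [ffun x => if x is Some x then h x else a i].
have ext_inj : injective ext.
  by move=> u v /ffunP e; apply/ffunP => x; have := e (Some x); rewrite !ffunE.
rewrite /lhom -(card_image ext_inj); apply: eq_card => h; rewrite !inE.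
apply/andP/imageP => [[/is_homP hh /eqP/ffunP ha]|[u /andP[/is_homP uh /forallP ua] ->]].
  exists [ffun x => h (Some x)].
    rewrite inE; apply/andP; split.
      by apply/is_homP => x y xy; rewrite !ffunE; apply: hh.
    apply/forallP => j; apply/implyP => ji.
    by rewrite !ffunE -ha !ffunE (negbTE ji).
  apply/ffunP => -[x|]; rewrite !ffunE //.
  by rewrite -ha !ffunE eqxx.
split.
  by apply/is_homP => -[x|] [y|] //= xy; rewrite !ffunE; apply: uh.
apply/eqP/ffunP => j; rewrite !ffunE; case: eqVneq => [->//|ji].
by have := implyP (ua j) ji; rewrite ffunE => /eqP.
Qed.

End LabelledHom.

(** * Words and the labelled graphs they spell *)

Definition letter (k : nat) : finType := ('I_k * {set 'I_k * 'I_k})%type.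

Definition extend k (F : dlgraph k) (a : letter k) : dlgraph k :=
  add_edges a.2 (introduce a.1 F).

Definition eval k (E : {set 'I_k * 'I_k}) (s : seq (letter k)) : dlgraph k :=
  foldl (@extend k) (add_edges E (discrete k)) s.

Lemma card_eval k E (s : seq (letter k)) : #|soe (eval E s)| = k + size s.
Proof.
rewrite /eval; elim/last_ind: s => [|s a IHs]; first by rewrite card_ord addn0.
by rewrite foldl_rcons size_rcons addnS -IHs card_option.
Qed.

(** * From path decompositions to words *)

Section WordOfDecomposition.
Variables (k : nat) (F : sgraph) (s : seq {set F}).
Hypothesis s_dec : path_decomposition s.
Hypothesis s_bag : forall B, B \in s -> #|B| <= k.

Let bag i : {set F} := nth set0 s i.
Let first (x : F) : nat := find (fun B : {set F} => x \in B) s.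

Lemma first_in x : x \in bag (first x).
Proof.
have [cov _ _] := s_dec; have [B Bs xB] := cov x.
by apply: (@nth_find _ set0 (fun B : {set F} => x \in B)); apply/hasP; exists B.
Qed.

Lemma first_min x t : x \in bag t -> first x <= t.
Proof.
move=> xt; rewrite leqNgt; apply/negP => /(@before_find _ set0) /=.
by rewrite -/(bag t) xt.
Qed.

Lemma bag_size x t : x \in bag t -> t < size s.
Proof.
by move=> xt; rewrite ltnNge; apply/negP => le; rewrite /bag nth_default ?inE in xt.
Qed.

Lemma bag_interval x t r : first x <= t -> t <= r -> x \in bag r -> x \in bag t.
Proof.
move=> xt tr xr; have [_ _ itv] := s_dec.
by apply: (subsetP (itv _ _ _ xt tr (bag_size xr))); rewrite inE first_in.
Qed.

Lemma bag_card t : #|bag t| <= k.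
Proof.
case: (ltnP t (size s)) => lt; first by apply/s_bag/mem_nth.
by rewrite /bag nth_default // cards0.
Qed.

(** A bag containing both ends comes no earlier than [first x]. As [y] has appeared by then, the
    interval property puts it in [bag (first x)]. *)
Lemma edge_bag x y : edge x y -> first y <= first x -> y \in bag (first x).
Proof.
move=> xy yx; have [_ cov _] := s_dec; have [B Bs /andP[xB yB]] := cov _ _ xy.
have eB : bag (index B s) = B by rewrite /bag nth_index.
apply: (bag_interval (r := index B s)) => //; last by rewrite eB.
by apply: first_min; rewrite eB.
Qed.

(* [D] is the subgraph of [F] induced on [p]; a vertex of [p] which is still
   active at a time [t] when all of [p] has appeared carries a label. *)
Definition induced_on (p : seq F) (D : dlgraph k) (h : soe D -> F) : Prop :=
  [/\ injective h,
      forall y, y \in p <-> exists x, h x = y,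
      forall x y, edge (h x) (h y) = edge x y
    & forall t y, all (fun z => first z <= t) p -> y \in p -> y \in bag t ->
        exists j, h (label D j) = y].

Lemma induced_start (p : seq F) : uniq p -> size p = k ->
  exists E (h : soe (@eval k E [::]) -> F), induced_on p h.
Proof.
move=> p_uniq p_size.
(* The empty list, where [k] is 0, is treated apart since [nth] needs a default vertex. *)
case: p p_uniq p_size => [|x0 p0] p_uniq p_size.
  exists set0; have no : 'I_k -> False by rewrite -p_size; case.
  exists (fun j => False_rect _ (no j)); split; try by move=> j; case: (no j).
    by move=> y; split=> // -[j]; case: (no j).
  by [].
set p := x0 :: p0 in p_uniq p_size *.
pose g (j : 'I_k) := nth x0 p j.
have g_inj : injective g.
  move=> j l /eqP; rewrite nth_uniq ?p_size ?ltn_ord // => /eqP; exact: val_inj.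
have gP y : y \in p <-> exists j, g j = y.
  split=> [/(nthP x0)[j]|[j <-]]; last by rewrite mem_nth ?p_size.
  by rewrite p_size => jk <-; exists (Ordinal jk).
exists [set jl | edge (g jl.1) (g jl.2)], g; split=> //.
  move=> j l; apply/idP/add_edgeP => [jl|[//|[j' [l' [/andP[_]]]]]].
    right; exists j, l; rewrite /= !ffunE /pattern !inE /= jl; split=> //.
    by rewrite andbT; apply: contraTneq jl => ->; rewrite edge_irr.
  by rewrite /= !ffunE !inE /= => jl <- <-; rewrite (edge_sym (g l')) orbb in jl.
by move=> t y _ /gP[j <-] _; exists j; rewrite /= ffunE.
Qed.

(** The first bag of [v] has at most [k] elements, one of which is [v], so some label [i] sits
    outside it. By the interval property its vertex is not in any bag from [first v] on, and the
    label can be moved to [v]. *)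
Lemma induced_extend p v (D : dlgraph k) (h : soe D -> F) :
  v \notin p -> all (fun z => first z <= first v) p -> induced_on p h ->
  exists a (h' : soe (extend D a) -> F), induced_on (rcons p v) h'.
Proof.
move=> vp pv [h_inj hP hE hlab].
have [i iB] : exists i, h (label D i) \notin bag (first v).
  apply/existsP; rewrite -negb_forall; apply/negP => /forallP allB.
  suff : k < #|bag (first v)| by rewrite ltnNge bag_card.
  rewrite (cardsD1 v) first_in ltnS.
  have lab_inj : injective (fun j => h (label D j)) by move=> j l /h_inj /label_inj.
  rewrite -[X in X <= _]card_ord -(card_codom lab_inj).
  apply/subset_leq_card/subsetP => _ /codomP[j ->]; rewrite !inE allB andbT.
  by apply: contraNneq vp => <-; apply/hP; exists (label D j).
pose h' (x : option (soe D)) := if x is Some x then h x else v.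
pose lab j := h' (intro_label i D j).
(* The letter records all edges of [F] between the new labels; those already present are simply
   added again. *)
pose a : letter k := (i, [set jl | edge (lab jl.1) (lab jl.2)]).
have h'_inj : injective h'.
  have hv x : h x <> v by move=> hx; case/negP: vp; apply/hP; exists x.
  by move=> [x|] [y|] //= => [/h_inj ->|/hv|/esym/hv].
(* The earlier neighbours of [v] lie in its first bag, so they carry labels, and none of these is
   the moved label [i]. *)
have newlab x : edge v (h x) -> exists2 j, j != i & label D j = x.
  move=> vx; have hxp : h x \in p by apply/hP; exists x.
  have xB := edge_bag vx (allP pv _ hxp).
  have [j /h_inj jx] := hlab _ _ pv hxp xB.
  by exists j => //; apply: contraNneq iB => <-; rewrite jx.
have labi : intro_label i D i = None by rewrite ffunE eqxx.
have labj j : j != i -> intro_label i D j = Some (label D j).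
  by move=> ji; rewrite ffunE (negbTE ji).
have patE j l : pattern a.2 j l = edge (lab j) (lab l).
  rewrite /pattern !inE /= (edge_sym (lab l)) orbb.
  by case: eqVneq => [->|//]; rewrite edge_irr.
exists a, h'; split=> //.
- move=> y; rewrite mem_rcons inE; split.
    case/orP=> [/eqP ->|/hP[x <-]]; [by exists None | by exists (Some x)].
  by case=> -[x|] <- /=; rewrite ?eqxx //; apply/orP; right; apply/hP; exists x.
- move=> x y; apply/idP/add_edgeP => [xy|[xy|[j [l []]]]].
  + case: x y xy => [x|] [y|] /= xy; last by rewrite edge_irr in xy.
    * by left; rewrite -hE.
    * right; have [|j ji jx] := newlab x; first by rewrite edge_sym.
      exists j, i; rewrite patE /lab labi labj // jx; split=> //.
    * right; have [j ji jy] := newlab y xy.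
      exists i, j; rewrite patE /lab labi labj // jy; split=> //.
  + by case: x y xy => [x|] [y|] //=; rewrite hE.
  + by rewrite patE => jl <- <-.
- move=> t y; rewrite all_rcons => /andP[vt pt].
  rewrite mem_rcons inE => /orP[/eqP ->|yp] yt; first by exists i; rewrite /= labi.
  (* A vertex active at a time [t] after [first v] was already in [bag (first v)], so it keeps its
     label. *)
  have yB := bag_interval (allP pv _ yp) vt yt.
  have [j jy] := hlab _ _ pv yp yB.
  exists j => /=; rewrite labj //=.
  by apply: contraNneq iB => <-; rewrite jy.
Qed.

Lemma word_of_decomposition : k <= #|F| -> exists E s', isomorphic (soe (@eval k E s')) F.
Proof.
move=> kF.
pose le x y := first x <= first y.
have le_trans : transitive le by move=> y x z; apply: leq_trans.
(* Induction on sorted lists from the right: a list of exactly [k] vertices is a starting graph, and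
   each further vertex costs one letter. *)
have build p : uniq p -> sorted le p -> k <= size p ->
    exists E s' (h : soe (@eval k E s') -> F), induced_on p h.
  elim/last_ind: p => [|p v IHp] p_uniq p_sorted.
    rewrite leqn0 => /eqP k0; have [|E [h Eh]] := induced_start p_uniq _; first by rewrite k0.
    by exists E, [::], h.
  rewrite leq_eqVlt => /orP[/eqP ek|].
    by have [//|E [h Eh]] := induced_start p_uniq _; exists E, [::], h.
  rewrite size_rcons ltnS => kp.
  move: p_uniq; rewrite rcons_uniq => /andP[vp p_uniq].
  move: p_sorted; rewrite (sorted_pairwise le_trans) pairwise_rcons.
  rewrite -(sorted_pairwise le_trans) => /andP[pv p_sorted].
  have [E [s' [h hp]]] := IHp p_uniq p_sorted kp.
  have [a [h' hp']] := induced_extend vp pv hp.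
  by exists E, (rcons s' a); rewrite /eval foldl_rcons; exists h'.
have [|||E [s' [h [h_inj hP hE _]]]] := build (sort le (enum F)).
- by rewrite sort_uniq enum_uniq.
- apply: sort_sorted => x y; exact: leq_total.
- by rewrite size_sort -cardE.
exists E, s', h => //; apply: inj_surj_bij => // y.
by apply/hP; rewrite mem_sort mem_enum.
Qed.

End WordOfDecomposition.

Lemma word_of_pathwidth k (F : sgraph) : 0 < k -> pathwidth F <= k - 1 -> k <= #|F| ->
  exists E s, isomorphic (soe (@eval k E s)) F.
Proof.
move=> k_gt0; rewrite /pathwidth; case: ex_minnP => w /asboolP[s s_dec <-] _ wk.
apply: word_of_decomposition s_dec _ => B Bs.
apply: (@leq_trans (\max_(B <- s) #|B|)); first exact: leq_bigmax_seq.
(* The width is a truncated predecessor, so a maximum bag size of 0 is a separate case. *)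
by move: wk; rewrite /width; case: (\max_(B <- s) #|B|) => // m; lia.
Qed.

(** * The automaton of classes and homomorphism counts *)

Section Automaton.
Local Open Scope ring_scope.
Variables (cF : sgraph -> Prop) (cF_iso : iso_closed cF) (k C : nat).
Variables (q : dlgraph k -> 'I_C).
Hypothesis qP : forall F1 F2, q F1 = q F2 <-> rec_equiv cF F1 F2.
Variables (G H : sgraph).

(** Labellings in [G] and in [H] are kept in one index set, so that a single linear functional can
    compare the two counts. *)
Let colour : finType := ({ffun 'I_k -> G} + {ffun 'I_k -> H})%type.

Definition clhom (F : dlgraph k) (x : colour) : nat :=
  match x with inl b => lhom F b | inr b => lhom F b end.

Definition ccompatible E (x : colour) : bool :=
  match x with inl b => compatible E b | inr b => compatible E b end.

Definition cagree i (x y : colour) : bool :=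
  match x, y with
  | inl b, inl c => agree_off i b c
  | inr b, inr c => agree_off i b c
  | _, _ => false
  end.

Lemma clhom_extend F a x :
  clhom (extend F a) x =
  (ccompatible a.2 x * \sum_(y | cagree a.1 y x) clhom F y)%N.
Proof.
by case: x => b; rewrite /= lhom_add_edges lhom_introduce big_sumType /=
  ?[X in (X + _)%N]big_pred0_eq ?[X in (_ + X)%N]big_pred0_eq ?addn0.
Qed.

Let space : vectType rat := {ffun 'I_C * colour -> rat^o}.

Definition state (F : dlgraph k) : space :=
  [ffun p => if p.1 == q F then (clhom F p.2)%:R else 0].

Variable delta : letter k * 'I_C -> 'I_C.
Hypothesis deltaP : forall a F, q (extend F a) = delta (a, q F).

(** The transition of [delta] on classes, tensored with the operator on count vectors given by
    [clhom_extend]. *)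
Definition step_fun (a : letter k) (v : space) : space :=
  [ffun p => \sum_(r | (delta (a, r.1) == p.1) && cagree a.1 r.2 p.2)
               (ccompatible a.2 p.2)%:R * (v r : rat)].

Lemma step_fun_linear a : linear (step_fun a).
Proof.
move=> c u v; apply/ffunP => p; rewrite !ffunE scaler_sumr -big_split /=.
by apply: eq_bigr => r _; rewrite !ffunE mulrDr; congr (_ + _); rewrite mulrCA.
Qed.

HB.instance Definition _ a :=
  GRing.isLinear.Build rat space space _ (step_fun a) (@step_fun_linear a).

Definition step (a : letter k) : 'End(space) := linfun (step_fun a).

Lemma step_state a F : step a (state F) = state (extend F a).
Proof.
apply/ffunP => -[c x]; rewrite lfunE !ffunE /= deltaP.
under eq_bigr => r _ do rewrite ffunE.
rewrite -(pair_big (fun c' => delta (a, c') == c) (fun y => cagree a.1 y x)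
  (fun c' y => (ccompatible a.2 x)%:R * (if c' == q F then (clhom F y)%:R else 0 : rat))) /=.
have off c' : c' != q F -> \sum_(y | cagree a.1 y x)
    (ccompatible a.2 x)%:R * (if c' == q F then (clhom F y)%:R else 0 : rat) = 0.
  by move=> /negbTE ->; rewrite big1 // => y _; rewrite mulr0.
(* The state is concentrated on the class [q F], so only that class contributes, and only if [delta]
   sends it to [c]. *)
case: eqP => [->|ne]; last first.
  by rewrite big1 // => c' /eqP cc'; rewrite off //; apply: contra_notN ne => /eqP <-.
rewrite (bigD1 (q F)) //= [X in _ + X]big1 ?addr0; last by move=> c' /andP[_ /off].
by rewrite eqxx clhom_extend natrM natr_sum mulr_sumr.
Qed.

(* Counts into [G] minus counts into [H], over the accepting classes. *)
Definition weight_fun (v : space) : rat^o :=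
  \sum_(p : 'I_C * colour | `[< exists2 F, q F = p.1 & cF (soe F) >])
    (if p.2 is inl _ then (v p : rat) else - (v p : rat)).

Lemma weight_fun_linear : linear weight_fun.
Proof.
move=> c u v; rewrite /weight_fun scaler_sumr -big_split /=.
apply: eq_bigr => -[d [b|b]] _; rewrite !ffunE //=.
by rewrite opprD scalerN.
Qed.

HB.instance Definition _ :=
  GRing.isLinear.Build rat space rat^o _ weight_fun weight_fun_linear.

(** Membership in [cF] is constant on classes, so one accepted member makes the whole class
    accepting. *)
Lemma accepting F : `[< exists2 F', q F' = q F & cF (soe F') >] = `[< cF (soe F) >].
Proof.
apply: asbool_equiv_eq; split=> [[F' /qP /(rec_equiv_soe cF_iso) <- //]|FF].
by exists F.
Qed.

Lemma weight_state F : linfun weight_fun (state F) =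
  if `[< cF (soe F) >] then (hom (soe F) G)%:R - (hom (soe F) H)%:R else 0 :> rat.
Proof.
pose acc c := `[< exists2 F, q F = c & cF (soe F) >].
pose term c (x : colour) : rat := if c == q F then
  (if x is inl _ then (clhom F x)%:R else - (clhom F x)%:R) else 0.
rewrite lfunE /= /weight_fun.
transitivity (\sum_(p : 'I_C * colour | acc p.1 && predT p.2) term p.1 p.2).
  apply: eq_big => [p|[c x] _]; first by rewrite andbT.
  by rewrite ffunE /term /=; case: eqP; case: x => // *; rewrite ?oppr0.
rewrite -(pair_big acc predT term) /=.
have off c : c != q F -> \sum_x term c x = 0.
  by move=> /negbTE cq; rewrite big1 // /term cq.
have at_q : \sum_x term (q F) x = (hom (soe F) G)%:R - (hom (soe F) H)%:R.
  rewrite big_sumType /= !hom_lhom !natr_sum -sumrN.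
  by congr (_ + _); apply: eq_bigr => b _; rewrite /term eqxx.
rewrite -accepting -/(acc (q F)); case: ifP => qF.
  by rewrite (bigD1 (q F)) //= at_q big1 ?addr0 // => c /andP[_ /off].
by rewrite big1 // => c accc; rewrite off //; apply: contraTneq accc => ->; rewrite qF.
Qed.

Lemma dim_space : dim space = (C * (#|G| ^ k + #|H| ^ k))%N.
Proof.
by rewrite /dim /= muln1 card_prod card_sum !card_ffun !card_ord.
Qed.

Lemma run_state x s : run step (state x) s = state (foldl (@extend k) x s).
Proof.
by rewrite /run; elim: s x => //= a s IHs x; rewrite step_state IHs.
Qed.

Lemma short_words :
  (forall E s, (size s < C * (#|G| ^ k + #|H| ^ k))%N -> cF (soe (@eval k E s)) ->
     hom (soe (eval E s)) G = hom (soe (eval E s)) H) ->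
  forall E s, cF (soe (@eval k E s)) ->
    hom (soe (eval E s)) G = hom (soe (eval E s)) H.
Proof.
move=> short E s Fs.
have vanish E' s' : linfun weight_fun (run step (state (add_edges E' (discrete k))) s') = 0.
  apply: (run_vanish (x := fun E => state (add_edges E (discrete k)))) => {}E' {}s'.
  rewrite dim_space run_state weight_state -/(eval E' s') => lt.
  (* Outside [cF] the weight is 0 by definition; inside, the counts agree by [short]. *)
  by case: asboolP => // Fs'; rewrite (short _ _ lt Fs') subrr.
move: (vanish E s); rewrite run_state weight_state -/(eval E s) asboolT // => e.
by apply/eqP; rewrite -(eqr_nat rat) -subr_eq0 e eqxx.
Qed.

End Automaton.

(** * The size bound *)

Theorem theorem23 (k : nat) (cF : sgraph -> Prop) (C : nat)
  (k_ge1 : 1 <= k)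
  (cF_iso : iso_closed cF)
  (cF_pw : forall F : sgraph, cF F -> pathwidth F <= k - 1)
  (cF_index : recognisability_index cF k C) :
  forall (n : nat) (G H : sgraph), #|G| <= n -> #|H| <= n ->
    hom_indist cF G H <->
    hom_indist (restr_size cF (2 * C * n ^ k + k - 1)) G H.
Proof.
move=> n G H Gn Hn; split=> [GH F [FF _]|GH F FF]; first exact: GH.
have [q [q_surj qP]] := cF_index.
(* Graphs with fewer than [k] vertices are not spelled by words; they are covered by the summand
   [k - 1] of the bound. *)
case: (ltnP #|F| k) => [Fk|kF].
  by apply: GH; split=> //; rewrite -ltnS; apply: leq_trans Fk _; lia.
have [E [s iso]] := word_of_pathwidth k_ge1 (cF_pw _ FF) kF.
rewrite -!(hom_iso _ iso).
(* Transitions are defined on a representative of each class, which exists by surjectivity of [q];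
   the congruence property makes them independent of it. *)
have [delta deltaP] : exists delta : letter k * 'I_C -> 'I_C,
    forall ac F, q F = ac.2 -> q (extend F ac.1) = delta ac.
  apply: (fin_all_exists (P := fun ac c => forall F, q F = ac.2 -> q (extend F ac.1) = c)).
  move=> [a c]; have [F0 <-] := q_surj c.
  exists (q (extend F0 a)) => F' /qP eqF; apply/qP.
  by apply: (rec_equiv_add_edges cF_iso); apply: (rec_equiv_introduce cF_iso).
apply: (short_words cF_iso qP (delta := delta)); last exact: cF_iso (isomorphic_sym iso) FF.
  by move=> a F'; exact: (deltaP (a, q F') F' erefl).
(* A word shorter than [C (|G|^k + |H|^k)], itself at most [2 C n^k], has at most [2 C n^k - 1]
   letters. With the [k] starting vertices this is the claimed bound. *)
move=> E' s' lt Fs'; apply: GH; split=> //; rewrite card_eval.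
have le m : m <= n -> m ^ k <= n ^ k by move=> mn; rewrite leq_exp2r.
have := leq_mul (leqnn C) (leq_add (le _ Gn) (le _ Hn)).
by move: lt; rewrite (mulnC 2) -!mulnA mul2n -addnn; lia.
Qed.
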